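(* Let $k$ be an algebraically closed field of characteristic $p>0$, let $m\geq 1$ be an integer with $m\mid (p-1)$, and fix a primitive $m$th root of unity $\zeta_m\in k^\times$. Let $h$ be a positive integer with \[ h<p\qquad\text{and}\qquad h\equiv -1\pmod{m}. \] Then there exists a good deformation datum with conductor $h$ (with respect to $m$ and $\zeta_m$).
   Context: Let $K=k(z)$ be the rational function field over $k$, regarded as the function field of $X=\mathbb{P}^1_k$, and let $\sigma:X\to X$ be the automorphism of order $m$ with $\sigma^*z=\zeta_m z$. A deformation datum is a differential form $\omega=f(z)\,\mathrm{d}z\in\Omega^1_{K/k}$ such that (a) $\sigma^*\omega=\zeta_m^c\,\omega$ for some $c\in\mathbb{Z}$, and (b) $\omega$ is logarithmic, i.e. $\omega=\mathrm{d}g/g$ for some $g\in K^\times$. A deformation datum $\omega$ is called good with conductor $h$ (where $h\geq 1$) if there is a point $x\in X$ with $\operatorname{ord}_x\omega=h-1$ and $\operatorname{ord}_y\omega\leq 0$ for all $y\neq x$. For $h\geq 2$ this says that $x$ is the unique zero of $\omega$ and that $h=\operatorname{ord}_x\omega+1$; for $h=1$ it says that $\omega$ has no zeroes. *)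

(* Defs.v *)
From HB Require Import structures.
From mathcomp Require Import all_boot all_order all_algebra.
From mathcomp Require Import generic_quotient ring zify.

Set Implicit Arguments.
Unset Strict Implicit.
Unset Printing Implicit Defensive.

Import GRing.Theory.
Local Open Scope ring_scope.
Local Open Scope quotient_scope.

Local Notation "x %:F" := (@tofrac _ x).

(* The module of differentials of k(z)/k is free with basis dz; the form
   f dz is represented by its coefficient f. The universal property is
   [d_universal]. *)
Definition ratform (k : closedFieldType) : Type := {fraction {poly k}}^o.
HB.instance Definition _ (k : closedFieldType) := GRing.Lmodule.on (ratform k).

Section ProjectiveLine.

Variable k : closedFieldType.
Implicit Types (f g : {fraction {poly k}}) (P Q : {poly k}) (a b zeta : k).

Local Notation K := {fraction {poly k}}.
Local Notation form := (ratform k).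

Definition fcst a : K := (a%:P)%:F.
Definition fvar : K := ('X : {poly k})%:F.

(* f = fnum f / fden f, not necessarily in lowest terms. The definitions below
   that use this representative do not depend on it: see [fderE], [fscaleE] and
   [ordE]. *)
Definition fnum f : {poly k} := (repr f).1.
Definition fden f : {poly k} := (repr f).2.

Definition fder f : K :=
  ((fnum f)^`() * fden f - fnum f * (fden f)^`())%:F / (fden f ^+ 2)%:F.

(* For zeta != 0, the k-automorphism of k(z) sending z to zeta z. *)
Definition fscale zeta f : K :=
  (fnum f \Po (zeta *: 'X))%:F / (fden f \Po (zeta *: 'X))%:F.

Definition coef (w : form) : K := w.
Definition dz : form := (1 : K).
Definition dif f : form := fder f *: dz.

(* sigma^*(f dz) = sigma^*(f) d(sigma^* z), where sigma^* z = zeta z. *)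
Definition pullback zeta (w : form) : form :=
  fscale zeta (coef w) *: dif (fscale zeta fvar).

(* As k is algebraically closed, the closed points of the projective line are
   its k-rational points. *)
Inductive P1 : Type := Aff of k | Infty.

(* Only meaningful for f != 0. *)
Definition ord (x : P1) f : int :=
  match x with
  | Aff a => (mup a (fnum f))%:Z - (mup a (fden f))%:Z
  | Infty => (size (fden f))%:Z - (size (fnum f))%:Z
  end.

Definition uniformizer (x : P1) : K :=
  match x with
  | Aff a => fvar - fcst a
  | Infty => fvar^-1
  end.

(* ord_x (u dt) = ord_x u for a uniformizer t at x; only meaningful for
   w != 0. *)
Definition form_ord (x : P1) (w : form) : int :=
  ord x (coef w / coef (dif (uniformizer x))).

Definition logarithmic (w : form) : Prop :=
  exists2 g : K, g != 0 & w = g^-1 *: dif g.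

Definition deformation_datum zeta (w : form) : Prop :=
  (exists c : int, pullback zeta w = fcst (zeta ^ c) *: w) /\ logarithmic w.

(* The zero form, which has infinite order at every point, is a deformation
   datum but is never good; as [form_ord] takes integer values, this has to
   be required separately. *)
Definition good_deformation_datum zeta (h : nat) (w : form) : Prop :=
  [/\ deformation_datum zeta w,
      w != 0 &
      exists x : P1, form_ord x w = h%:Z - 1
        /\ forall y : P1, y <> x -> form_ord y w <= 0].

Lemma fden_neq0 f : fden f != 0.
Proof. exact: denom_ratioP. Qed.

Lemma fracE f : f = (fnum f)%:F / (fden f)%:F.
Proof.
rewrite -[LHS]reprK /fnum /fden; move: (repr f) => r.
unlock tofrac.
have -> : (\pi_({fraction {poly k}}) (Ratio r.2 1))^-1
        = \pi_({fraction {poly k}}) (FracField.invf (Ratio r.2 1))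
  by apply: esym; exact: FracField.pi_inv.
have E : forall a b : {ratio {poly k}},
    (\pi_({fraction {poly k}}) a : K) * \pi_({fraction {poly k}}) b
    = \pi_({fraction {poly k}}) (FracField.mulf a b)
  by move=> a b; apply: esym; exact: FracField.pi_mul.
rewrite E /FracField.invf /FracField.mulf.
by rewrite !numden_Ratio ?oner_neq0 ?denom_ratioP // mulr1 mul1r Ratio_numden.
Qed.

Lemma frac_eq P Q P1 Q1 : Q != 0 -> Q1 != 0 ->
  (P%:F / Q%:F == P1%:F / Q1%:F :> K) = (P * Q1 == P1 * Q).
Proof.
by move=> Q0 Q10; rewrite eqr_div ?tofrac_eq0 // -!tofracM tofrac_eq.
Qed.

Lemma fnum_fden P Q : Q != 0 ->
  fnum (P%:F / Q%:F) * Q = P * fden (P%:F / Q%:F).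
Proof.
move=> Q0; apply/eqP; rewrite -frac_eq ?fden_neq0 //.
by rewrite -fracE.
Qed.

Lemma fderE P Q : Q != 0 ->
  fder (P%:F / Q%:F) = (P^`() * Q - P * Q^`())%:F / (Q ^+ 2)%:F.
Proof.
move=> Q0; rewrite /fder; have := fnum_fden P Q0.
have := fden_neq0 (P%:F / Q%:F).
move: (fnum _) (fden _) => N D D0 E.
apply/eqP; rewrite frac_eq ?expf_neq0 //; apply/eqP.
have E' : N^`() * Q + N * Q^`() = P^`() * D + P * D^`().
  by rewrite -!derivM E.
apply/eqP; rewrite -subr_eq0; apply/eqP.
transitivity (D * Q * (N^`() * Q + N * Q^`() - (P^`() * D + P * D^`()))
              - (N * Q - P * D) * (D^`() * Q + D * Q^`())); first by ring.
by rewrite E E' !subrr mulr0 mul0r subr0.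
Qed.

Lemma comp_scale_neq0 zeta Q :
  zeta != 0 -> Q != 0 -> Q \Po (zeta *: 'X) != 0.
Proof.
move=> z0; apply: contra => /eqP /(congr1 (fun P => P \Po (zeta^-1 *: 'X))).
rewrite comp_poly0 -comp_polyA comp_polyZ comp_polyX scalerA mulfV //.
by rewrite scale1r comp_polyXr => ->.
Qed.

Lemma fscaleE zeta P Q : zeta != 0 -> Q != 0 ->
  fscale zeta (P%:F / Q%:F)
  = (P \Po (zeta *: 'X))%:F / (Q \Po (zeta *: 'X))%:F.
Proof.
move=> z0 Q0; rewrite /fscale; apply/eqP.
by rewrite frac_eq ?comp_scale_neq0 ?fden_neq0 // -!comp_polyM fnum_fden.
Qed.

Lemma ordE (x : P1) P Q : P != 0 -> Q != 0 ->
  ord x (P%:F / Q%:F) =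
  match x with
  | Aff a => (mup a P)%:Z - (mup a Q)%:Z
  | Infty => (size Q)%:Z - (size P)%:Z
  end.
Proof.
move=> P0 Q0; have := fnum_fden P Q0; have := fden_neq0 (P%:F / Q%:F).
rewrite /ord; move: (fnum _) (fden _) => N D D0 E.
have N0 : N != 0.
  by apply: contraNneq (mulf_neq0 P0 D0) => N0; rewrite -E N0 mul0r.
case: x => [a|].
  have := congr1 (mup a) E; rewrite !mupM // => e; lia.
have := congr1 (fun R : {poly k} => size R) E.
rewrite !size_mul // => e.
have sN : (0 < size N)%N by rewrite size_poly_gt0.
have sP : (0 < size P)%N by rewrite size_poly_gt0.
move: e sN sP; move: (size N) (size P) (size Q) (size D) => a b c e.
lia.
Qed.

Lemma fderC a : fder (fcst a) = 0.
Proof.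
rewrite /fcst -[_%:F]divr1 -tofrac1 fderE ?oner_neq0 //.
by rewrite derivC -(polyC1 k) derivC mul0r mulr0 subrr tofrac0 mul0r.
Qed.

Lemma fderX : fder fvar = 1.
Proof.
rewrite /fvar -[_%:F]divr1 -tofrac1 fderE ?oner_neq0 //.
by rewrite derivX -(polyC1 k) derivC mulr0 subr0 mulr1 expr1n tofrac1 divr1.
Qed.

Lemma fderD f g : fder (f + g) = fder f + fder g.
Proof.
rewrite [in LHS](fracE f) [in LHS](fracE g) /(fder f) /(fder g).
have := fden_neq0 f; have := fden_neq0 g.
move: (fnum f) (fden f) (fnum g) (fden g) => N D M E E0 D0.
rewrite !addf_div ?tofrac_eq0 ?expf_neq0 // -!(tofracM, tofracD).
rewrite fderE ?mulf_neq0 //.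
apply/eqP; rewrite frac_eq ?expf_neq0 ?mulf_neq0 ?expf_neq0 //.
rewrite derivD !derivM; apply/eqP; ring.
Qed.

Lemma fderM f g : fder (f * g) = fder f * g + f * fder g.
Proof.
rewrite {1 3}(fracE f) {1 2}(fracE g) /(fder f) /(fder g).
have := fden_neq0 f; have := fden_neq0 g.
move: (fnum f) (fden f) (fnum g) (fden g) => N D M E E0 D0.
rewrite !mulf_div -!(tofracM, tofracD) fderE ?mulf_neq0 //.
rewrite addf_div ?tofrac_eq0 ?mulf_neq0 ?expf_neq0 // -!(tofracM, tofracD).
apply/eqP; rewrite frac_eq ?mulf_neq0 ?expf_neq0 //.
rewrite !derivM; apply/eqP; ring.
Qed.

Lemma quotient_rule_aux (F : fieldType) (n n' e e' : F) : e != 0 ->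
  e^-1 * n' - e^-1 * (n / e) * e' = (n' * e - n * e') / (e * e).
Proof. by move=> e0; field. Qed.

Lemma d_universal (V : lmodType K) (D : K -> V) :
    (forall f g, D (f + g) = D f + D g) ->
    (forall f g, D (f * g) = f *: D g + g *: D f) ->
    (forall a, D (fcst a) = 0) ->
  exists phi : {linear form -> V},
    (forall f, D f = phi (dif f)) /\
    (forall psi : {linear form -> V}, (forall f, D f = psi (dif f)) -> psi =1 phi).
Proof.
move=> DD DM DC.
have DX P : D P%:F = P^`()%:F *: D fvar.
  elim/poly_ind: P => [|P c IH].
    by rewrite linear0 tofrac0 scale0r -(DC 0) /fcst tofrac0.
  rewrite tofracD DD DC addr0 tofracM DM IH derivMXaddC tofracD tofracM.
  by rewrite scalerA scalerDl [_ * fvar]mulrC.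
have Dfder f : D f = fder f *: D fvar.
  have D0 : (fden f)%:F != 0 :> K by rewrite tofrac_eq0 fden_neq0.
  have : D (f * (fden f)%:F) = D (fnum f)%:F.
    by congr D; rewrite {1}(fracE f) divfK.
  rewrite DM (DX (fden f)) (DX (fnum f)) => /(congr1 (fun v => (fden f)%:F^-1 *: v)).
  rewrite scalerDr !scalerA mulVf // scale1r => /eqP.
  rewrite eq_sym addrC -subr_eq -scalerBl => /eqP <-; congr (_ *: _).
  have fE := fracE f; rewrite /fder.
  move: (fnum f) (fden f) D0 fE => N E E0 ->.
  rewrite tofracB !tofracM.
  exact: quotient_rule_aux.
have lin : scalable (fun w : form => coef w *: D fvar).
  by move=> a w /=; rewrite scalerA.
have zm : zmod_morphism (fun w : form => coef w *: D fvar).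
  by move=> v w /=; rewrite -scalerBl.
pose phi0 : form -> V := fun w => coef w *: D fvar.
pose m1 := GRing.isZmodMorphism.Build _ _ phi0 zm.
pose m2 := GRing.isScalable.Build _ _ _ _ phi0 lin.
pose phi : {linear form -> V} := HB.pack phi0 m1 m2.
have phid f : D f = phi (dif f).
  by rewrite Dfder /= /phi0 /dif /coef /dz /= [_ *: 1]mulr1.
exists phi; split=> // psi psid w.
have -> : w = coef w *: dif fvar.
  by rewrite /dif fderX scale1r /coef /dz [RHS]mulr1.
by rewrite [LHS]linearZ [RHS]linearZ /= -psid phid.
Qed.

Lemma fscale_cst zeta a : zeta != 0 -> fscale zeta (fcst a) = fcst a.
Proof.
move=> z0; rewrite /fcst -[X in fscale _ X]divr1 -tofrac1 fscaleE ?oner_neq0 //.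
by rewrite comp_polyC -(polyC1 k) comp_polyC polyC1 tofrac1 divr1.
Qed.

Lemma fscale_var zeta : zeta != 0 -> fscale zeta fvar = fcst zeta * fvar.
Proof.
move=> z0; rewrite {1}/fvar -[X in fscale _ X]divr1 -tofrac1.
rewrite fscaleE ?oner_neq0 // comp_polyX -(polyC1 k) comp_polyC polyC1 tofrac1.
by rewrite divr1 -mul_polyC tofracM.
Qed.

Lemma fscaleD zeta f g : zeta != 0 ->
  fscale zeta (f + g) = fscale zeta f + fscale zeta g.
Proof.
move=> z0; rewrite [in LHS](fracE f) [in LHS](fracE g).
rewrite addf_div ?tofrac_eq0 ?fden_neq0 // -!(tofracM, tofracD).
rewrite fscaleE ?mulf_neq0 ?fden_neq0 // comp_polyD !comp_polyM.
by rewrite addf_div ?tofrac_eq0 ?comp_scale_neq0 ?fden_neq0 // -!(tofracM, tofracD).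
Qed.

Lemma fscaleM zeta f g : zeta != 0 ->
  fscale zeta (f * g) = fscale zeta f * fscale zeta g.
Proof.
move=> z0; rewrite [in LHS](fracE f) [in LHS](fracE g).
rewrite mulf_div -!tofracM fscaleE ?mulf_neq0 ?fden_neq0 // !comp_polyM.
by rewrite mulf_div -!tofracM.
Qed.

End ProjectiveLine.

(* Main.v *)
Require Import Defs.
From mathcomp Require Import all_boot all_order all_algebra.
From mathcomp Require Import separable zify.
Import GRing.Theory.
Local Open Scope ring_scope.

(** The form dz / Q, where Q is the product of the z - s for s in a set S of
h + 1 points of the prime field F_p, has simple poles at S with residues 1 / Q'(s)
in F_p, hence is logarithmic, and its only zero is at infinity, of order h - 1.
It remains to choose S stable under multiplication by zeta. If h + 1 < p, take
the inverse image under the m-th power map of (h + 1) / m of the (p - 1) / m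
roots of T^((p - 1) / m) - 1. If h + 1 = p, then m divides both p and p - 1, so
m = 1 and S = F_p will do. *)

Local Notation "x %:F" := (@tofrac _ x).

(** The images of 0, ..., p - 1 are p distinct roots of ['X^p - 'X]; a fixed point outside them
    would be one root too many for the degree. *)
Lemma Frobenius_fixed_nat (F : fieldType) (p : nat) (charp : p \in [pchar F]) (x : F) :
  x ^+ p = x -> exists n : nat, n%:R = x.
Proof.
move=> xp; have p_gt1 : (1 < p)%N by rewrite prime_gt1 ?(pcharf_prime charp).
pose s : seq F := [seq i%:R | i <- iota 0 p].
have [/mapP[n _ ->]|xs] := boolP (x \in s); first by exists n.
have sz : size ('X^p - 'X : {poly F}) = p.+1.
  by rewrite size_polyDl size_polyXn // size_polyN size_polyX ltnS.
suff /eqP : 'X^p - 'X = 0 :> {poly F} by rewrite -size_poly_eq0 sz.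
apply: (@roots_geq_poly_eq0 _ _ (x :: s)); last by rewrite sz /= size_map size_iota.
  apply/allP=> y; rewrite inE /root !hornerE => /predU1P[->|].
    by rewrite xp subrr.
  by case/mapP=> n _ ->; rewrite -(pFrobenius_autE charp) pFrobenius_aut_nat subrr.
rewrite /= xs map_inj_in_uniq ?iota_uniq // => i j.
rewrite !mem_iota /= !add0n => ip jp.
wlog le_ij : i j ip jp / (i <= j)%N => [hw|/eqP].
  by case: (leqP i j) => [|/ltnW] le e; [|symmetry]; apply: hw.
rewrite eq_sym -subr_eq0 -natrB // -(dvdn_pcharf charp) => /dvdnP[[|c] e]; nia.
Qed.

Lemma XpsubX_separable (F : fieldType) (p : nat) (charp : p \in [pchar F]) :
  separable_poly ('X^p - 'X : {poly F}).
Proof.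
rewrite unlock derivB derivXn derivX -mulr_natl.
have -> : p%:R = 0 :> {poly F} by rewrite -polyC_natr (pcharf0 charp).
by rewrite mul0r sub0r -(scaleN1r 1) coprimepZr ?coprimep1 ?oppr_eq0 ?oner_neq0.
Qed.

Section LagrangeBasis.

Variables (F : fieldType) (S : seq F).
Hypothesis uniqS : uniq S.

(** Unnormalised Lagrange basis: if Q is the product over all of [S] and s lies in [S], then [L s]
    is Q / (X - s), with value Q'(s) at s. *)
Let L s : {poly F} := \prod_(t <- rem s S) ('X - t%:P).

Lemma lagrange_root s t : t \in S -> ((L s).[t] == 0) = (t != s).
Proof.
move=> tS; rewrite -/(root (L s) t) root_prod_XsubC mem_rem_uniq // inE tS.
by rewrite andbT.
Qed.

(** The difference of the two sides has degree below [size S] and vanishes on [S]. Divided by Q,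
    this is the partial fraction expansion of 1 / Q. *)
Lemma lagrange_sum1 : S != [::] -> \sum_(s <- S) ((L s).[s])^-1 *: L s = 1.
Proof.
move=> S0; have szS : (0 < size S)%N by case: (S) S0.
apply/eqP; rewrite -subr_eq0; apply/eqP.
apply: (@roots_geq_poly_eq0 _ _ S) => //; last first.
  rewrite (leq_trans (size_polyD _ _)) // geq_max size_polyN size_poly1 szS andbT.
  rewrite (leq_trans (size_sum _ _ _)) //; apply/bigmax_leqP_seq => s sS _.
  rewrite (leq_trans (size_scale_leq _ _)) // size_prod_XsubC size_rem //.
  by rewrite prednK.
apply/allP=> t tS; rewrite /root !hornerE horner_sum (bigD1_seq t) //=.
rewrite hornerZ mulVf ?lagrange_root ?eqxx // big1 ?addr0 ?subrr // => s st.
by apply/eqP; rewrite hornerZ mulf_eq0 lagrange_root // [t == s]eq_sym st orbT.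
Qed.

End LagrangeBasis.

Section Forms.

Variable k : closedFieldType.
Implicit Types (S : seq k) (P Q : {poly k}) (s a zeta : k).
Local Notation K := {fraction {poly k}}.

Lemma fder_tofrac P : fder P%:F = P^`()%:F.
Proof.
rewrite -[P%:F]divr1 -tofrac1 fderE ?oner_neq0 // -(polyC1 k) derivC.
by rewrite mulr0 subr0 mulr1 expr1n tofrac1 divr1.
Qed.

Lemma fderXn (f : K) n : f != 0 -> fder (f ^+ n) = f ^+ n * (n%:R / f * fder f).
Proof.
move=> f0; elim: n => [|n IHn].
  by rewrite expr0 !mul0r mulr0 -tofrac1 -(polyC1 k) fder_tofrac derivC tofrac0.
rewrite exprS fderM {}IHn -natr1 mulrDl mul1r mulrDl mulrDr.
move: (fder f) => f'; rewrite addrC -!mulrA; congr (_ + _).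
by rewrite [f ^+ n * _]mulrCA mulVKf // mulrC.
Qed.

Lemma fder_prod_XsubC_exp S (n : k -> nat) :
  let g := \prod_(s <- S) (('X - s%:P)%:F) ^+ n s in
  fder g = g * \sum_(s <- S) (n s)%:R / ('X - s%:P)%:F.
Proof.
elim: S => [|s S IHS] /=.
  by rewrite !big_nil mulr0 -tofrac1 -(polyC1 k) fder_tofrac derivC tofrac0.
rewrite !big_cons fderM IHS fderXn ?tofrac_eq0 ?polyXsubC_eq0 //.
rewrite fder_tofrac derivXsubC tofrac1 mulr1 mulrDr mulrAC [in LHS]mulrA.
by congr (_ + _); rewrite mulrA.
Qed.

(** Each residue 1 / Q'(s) is the image of some natural number [n s]. The product g of the (z -
    s)^(n s) then has dg / g equal to the partial fraction expansion of dz / Q. *)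
Lemma logarithmic_inv_prod_XsubC (p : nat) (charp : p \in [pchar k]) S :
    S != [::] -> uniq S -> {in S, forall s, s ^+ p = s} ->
  logarithmic ((\prod_(s <- S) ('X - s%:P))%:F^-1 : ratform k).
Proof.
move=> S0 uS fixS.
pose L s := \prod_(t <- rem s S) ('X - t%:P).
(* The boolean implication makes the claim hold for every s, so that [xchoose] yields a total
   function; its values outside [S] are irrelevant. *)
have exn s : exists n : nat, (s \in S) ==> (n%:R == (L s).[s]^-1).
  have [sS|_] := boolP (s \in S); last by exists 0%N.
  have [|n <-] := @Frobenius_fixed_nat _ _ charp ((L s).[s])^-1; last by exists n; rewrite eqxx.
  (* The value of [L s] at s is a product of differences of points fixed by Frobenius, which is a
     ring morphism. *)
  rewrite exprVn; congr (_^-1); rewrite horner_prod -(pFrobenius_autE charp).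
  rewrite rmorph_prod; apply: eq_big_seq => t /mem_rem tS.
  by rewrite hornerXsubC rmorphB /= !pFrobenius_autE !fixS.
pose n s := xchoose (exn s).
pose g := \prod_(s <- S) (('X - s%:P)%:F) ^+ n s.
have g0 : g != 0.
  rewrite prodf_seq_neq0; apply/allP=> s _ /=.
  by rewrite expf_neq0 // tofrac_eq0 polyXsubC_eq0.
exists g => //; rewrite /dif /dz fder_prod_XsubC_exp -/g.
rewrite [_ *: _]mulrA [RHS]mulr1 mulKf //.
set Q := \prod_(s <- S) ('X - s%:P).
have Q0 : Q%:F != 0 by rewrite tofrac_eq0 monic_neq0 ?monic_prod_XsubC.
apply: (mulfI Q0); rewrite mulfV // mulr_sumr -[LHS]tofrac1.
rewrite -[in LHS](lagrange_sum1 _ _ uS S0).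
rewrite rmorph_sum /=; apply: eq_big_seq => s sS.
have /implyP/(_ sS)/eqP <- := xchooseP (exn s).
have -> : Q = ('X - s%:P) * L s by rewrite /Q (big_rem s).
rewrite -/(n s) -/(L s) scaler_nat tofracMn tofracM.
rewrite mulr_natl mulrnAr; congr (_ *+ _).
have tz0 : ('X - s%:P)%:F != 0 by rewrite tofrac_eq0 polyXsubC_eq0.
by rewrite [RHS]mulrC (mulKf tz0).
Qed.

(** At infinity d(1/z) = - z^-2 dz, so the order is deg Q - 2, that is, [size Q] - 3. *)
Lemma form_ord_inv (x : P1 k) Q : Q != 0 ->
  form_ord x (Q%:F^-1 : ratform k) =
  match x with
  | Aff a => - (mup a Q)%:Z
  | Infty => (size Q)%:Z - 3
  end.
Proof.
move=> Q0; have difE (f : K) : coef (dif f) = fder f by exact: mulr1.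
rewrite /form_ord difE /coef; case: x => [a|].
  have -> : fder (uniformizer (Aff a)) = 1.
    by rewrite /uniformizer /fvar /fcst -tofracB fder_tofrac derivXsubC tofrac1.
  rewrite divr1 -[Q%:F^-1]mul1r -tofrac1 ordE ?oner_neq0 //.
  have -> : mup a 1 = 0%N by have := mu_prod_XsubC a [::]; rewrite big_nil.
  by rewrite sub0r.
have -> : fder (uniformizer (Infty k)) = (- 1)%:F / ('X ^+ 2)%:F.
  rewrite /uniformizer /fvar -[_^-1]mul1r -tofrac1 fderE ?polyX_eq0 //.
  by rewrite derivX -(polyC1 k) derivC mul0r sub0r mulr1 polyC1.
rewrite invf_div -[Q%:F^-1]mul1r mulf_div mul1r -tofracM.
rewrite ordE ?mulf_neq0 ?expf_neq0 ?polyX_eq0 ?oppr_eq0 ?oner_neq0 //.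
by rewrite mulrN1 size_polyN size_polyXn.
Qed.

End Forms.

Lemma stable_Frobenius_fixed_points (k : closedFieldType) (p m N : nat) (zeta : k) :
    p \in [pchar k] -> (0 < m)%N -> (m %| p - 1)%N -> zeta ^+ m = 1 ->
    (0 < N)%N -> (N <= p)%N -> (m %| N)%N ->
  exists S : seq k, [/\ uniq S, size S = N, {in S, forall s, s ^+ p = s} &
    let Q := \prod_(s <- S) ('X - s%:P) in Q \Po (zeta *: 'X) = Q].
Proof.
move=> charp m0 mp1 zm N0 Np mN.
have p_gt1 : (1 < p)%N by rewrite prime_gt1 ?(pcharf_prime charp).
(* The roots of such a Q will form S: they are distinct because ['X^p - 'X] is separable, and fixed
   by Frobenius because Q divides it. *)
suff [Q [sQ QP Qz]] : exists Q : {poly k},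
    [/\ size Q = N.+1, Q %| 'X^p - 'X & Q \Po (zeta *: 'X) = Q].
  have [S QE] := closed_field_poly_normal Q.
  have Q0 : Q != 0 by rewrite -size_poly_gt0 sQ.
  have lQ0 : lead_coef Q != 0 by rewrite lead_coef_eq0.
  have PE : \prod_(s <- S) ('X - s%:P) = (lead_coef Q)^-1 *: Q.
    by rewrite {2}QE scalerA mulVf ?scale1r.
  exists S; split.
  - rewrite -separable_prod_XsubC PE.
    apply: dvdp_separable (XpsubX_separable _ _ charp).
    by rewrite dvdpZl ?invr_eq0.
  - by apply: succn_inj; rewrite -sQ QE size_scale // size_prod_XsubC.
  - move=> s sS; have : root ('X^p - 'X) s.
      by apply: root_dvdp QP _; rewrite QE rootZ // root_prod_XsubC.
    by rewrite /root !hornerE subr_eq0 => /eqP.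
  - by rewrite /= PE comp_polyZ Qz.
have [pN|neqNp] := eqVneq N p.
  have m1 : m = 1%N.
    by apply/eqP; rewrite -dvdn1 -(dvdn_addr 1 mp1) subnK // -pN.
  exists ('X^p - 'X); split=> //.
    by rewrite size_polyDl size_polyXn ?pN // size_polyN size_polyX ltnS.
  by move: zm; rewrite m1 expr1 => ->; rewrite scale1r comp_polyXr.
have [ts tsE] := closed_field_poly_normal ('X^((p - 1) %/ m) - 1 : {poly k}).
have e0 : (0 < (p - 1) %/ m)%N by rewrite divn_gt0 // dvdn_leq // subn_gt0.
move: tsE; rewrite -polyC1 lead_coefXnsubC // scale1r => tsE.
pose q := \prod_(t <- take (N %/ m) ts) ('X - t%:P).
have sts : size ts = ((p - 1) %/ m)%N.
  by apply: succn_inj; rewrite -(size_prod_XsubC _ id) -tsE size_XnsubC.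
have szq : size q = (N %/ m).+1.
  (* Here N differs from p, so N <= p - 1 and there are enough roots to take N / m of them. *)
  rewrite size_prod_XsubC size_takel // sts leq_div2r //; lia.
exists (q \Po 'X^m); split.
- have := size_comp_poly q 'X^m; rewrite szq size_polyXn /= divnK // => szQ.
  (* The degree formula only gives the predecessor of the size; N > 0 excludes size zero. *)
  by rewrite -szQ prednK // lt0n; apply/eqP=> z; move: N0; rewrite -szQ z.
- have qdvd : q %| 'X^((p - 1) %/ m) - 1%:P.
    by rewrite tsE -(cat_take_drop (N %/ m) ts) big_cat dvdp_mulIl.
  (* Substituting X^m turns the multiple of q into X^(p - 1) - 1, which divides X^p - X. *)
  apply: dvdp_trans (dvdp_comp_poly 'X^m qdvd) _.
  rewrite comp_polyB comp_polyC comp_Xn_poly -exprM [(m * _)%N]mulnC divnK //.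
  apply/dvdpP; exists 'X; rewrite mulrBr -exprS (_ : (p - 1).+1 = p); last by lia.
  by rewrite polyC1 mulr1.
- by rewrite -comp_polyA comp_Xn_poly exprZn zm scale1r.
Qed.

Theorem proposition1p4 (k : closedFieldType) (p : nat) (charp : p \in [pchar k])
    (m : nat) (m_ge1 : (1 <= m)%N) (m_dvd : (m %| p - 1)%N)
    (zeta : k) (zeta_prim : m.-primitive_root zeta)
    (h : nat) (h_ge1 : (1 <= h)%N) (h_lt_p : (h < p)%N)
    (h_mod : (h%:Z = - 1 %[mod m%:Z])%Z) :
  exists w : ratform k, good_deformation_datum zeta h w.
Proof.
have m_dvdN : (m %| h.+1)%N.
  move/eqP: h_mod; rewrite eqz_mod_dvd opprK => mh.
  by have : (m%:Z %| h.+1%:Z)%Z by rewrite -addn1 PoszD.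
have [S [uS sS fixS Qz]] := @stable_Frobenius_fixed_points _ _ _ h.+1 zeta
  charp m_ge1 m_dvd (prim_expr_order zeta_prim) isT h_lt_p m_dvdN.
set Q := \prod_(s <- S) _ in Qz.
have Q0 : Q != 0 by rewrite monic_neq0 ?monic_prod_XsubC.
have z0 : zeta != 0.
  apply: contra_eq_neq (prim_expr_order zeta_prim) => ->.
  by rewrite expr0n gtn_eqF // eq_sym oner_neq0.
exists (Q%:F^-1 : {fraction {poly k}}); split.
- split; last first.
    by apply: (@logarithmic_inv_prod_XsubC _ _ charp) => //; rewrite -size_eq0 sS.
  (* The exponent is 1: Q is invariant under scaling, and dz contributes the factor [zeta]. *)
  exists 1; rewrite expr1z /pullback fscale_var // /dif fderM fderC mul0r add0r fderX.
  rewrite mulr1 /coef /dz -[Q%:F^-1]mul1r -tofrac1 fscaleE // Qz.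
  rewrite -(polyC1 k) comp_polyC tofrac1 mul1r.
  by rewrite /GRing.scale /= mulr1 mulrC.
- by rewrite invr_eq0 tofrac_eq0.
- exists (Infty k); split.
    (* Q has size h + 2, so the order at infinity is h - 1. *)
    rewrite form_ord_inv // size_prod_XsubC sS; lia.
  by case=> [a|//] _; rewrite form_ord_inv //; lia.
Qed.
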